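(* Let $\alpha\in(0,1)$ be irrational, $\alpha=[a_1,a_2,a_3,\dots]$. Let $r$ be a positive integer with Ostrowski representation $r=\sum_{h=0}^{N}c_h q_h$. Then $r=r_{k_j}$ for some $j>0$ if and only if $c_0=c_1=0$ and $\min\{h: c_h>0\}$ is even and at least $2$. Moreover, a positive integer $r$ is of the form $r_k$ for some $k$ if and only if either $r=r_{k_j}$ for some $j>0$, or $r=r_{k_j}+c_1q_1+1$ for some $j\ge 0$ and some integer $c_1$ with $1\le c_1\le a_2$.
   Context: Write $\alpha=[a_1,a_2,\dots]=1/(a_1+1/(a_2+\cdots))$ with positive integers $a_h$, and let $p_n/q_n=[a_1,\dots,a_n]$ be the convergents: $p_0=0,\ q_0=1,\ p_1=1,\ q_1=a_1$, $p_{n+1}=a_{n+1}p_n+p_{n-1}$, $q_{n+1}=a_{n+1}q_n+q_{n-1}$ for $n\ge1$. For $k\ge 0$ let $r_k:=\min\{r\ge 0:\lfloor r\alpha\rfloor=k\}$ and $t_k:=\#\{r\ge0:\lfloor r\alpha\rfloor=k\}$. One has $t_k\in\{a_1,a_1+1\}$ for all $k$, and $t_0=a_1+1$. Let $k_0<k_1<k_2<\cdots$ be the increasing enumeration of all $k\ge0$ with $t_k=a_1+1$ (so $k_0=0$ and $r_{k_0}=0$); $(r_{k_j})_{j\ge0}$ is the corresponding subsequence of $(r_k)$. Ostrowski representation: every positive integer $r$ can be written uniquely as $r=\sum_{h=0}^N c_hq_h$ with integers $c_h$ such that $0\le c_0\le a_1-1$, $0\le c_h\le a_{h+1}$ for $h\ge1$,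 $c_{h-1}=0$ whenever $c_h=a_{h+1}$ ($h\ge1$), and $c_N>0$. *)

(* Defs.v *)
From mathcomp Require Import all_boot all_order all_algebra finmap.
From mathcomp Require Import boolp classical_sets functions cardinality reals.
From mathcomp Require Import topology normedtype.
From mathcomp Require Import ring lra.
Set Implicit Arguments.
Unset Strict Implicit.
Unset Printing Implicit Defensive.
Import Order.TTheory GRing.Theory Num.Theory.
Import numFieldNormedType.Exports.
Local Open Scope classical_set_scope.
Local Open Scope ring_scope.

(* Partial quotients are a sequence a : nat -> nat read from index 1 on;
   a 0 is never used. *)

(* [a_1, ..., a_n], with value 0 for n = 0 *)
Definition cfrac (R : realType) (a : nat -> nat) (n : nat) : R :=
  foldr (fun b x => (b%:R + x)^-1) 0 [seq a h | h <- iota 1 n].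

Definition is_cfrac (R : realType) (alpha : R) (a : nat -> nat) : Prop :=
  (forall h, (1 <= h)%N -> (0 < a h)%N) /\
  cfrac R a n @[n --> \oo] --> alpha.

Fixpoint cf_num (a : nat -> nat) (n : nat) : nat :=
  match n with
  | 0%N => 0
  | m1.+1 =>
    match m1 with
    | 0%N => 1
    | m.+1 => a n * cf_num a m1 + cf_num a m
    end
  end%N.

Fixpoint cf_den (a : nat -> nat) (n : nat) : nat :=
  match n with
  | 0%N => 1
  | m1.+1 =>
    match m1 with
    | 0%N => a 1
    | m.+1 => a n * cf_den a m1 + cf_den a m
    end
  end%N.

Lemma cf_den_gt0 (a : nat -> nat) (n : nat) :
  (forall h, (1 <= h)%N -> (0 < a h)%N) -> (0 < cf_den a n)%N.
Proof.
move=> a0; suff /andP[]: (0 < cf_den a n)%N && (0 < cf_den a n.+1)%N by [].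
elim: n => [|n /andP[h1 h2]]; first by rewrite /= a0.
rewrite h2 /=; change (0 < a n.+2 * cf_den a n.+1 + cf_den a n)%N.
by rewrite addn_gt0 h1 orbT.
Qed.

Lemma cfrac_convergent (R : realType) (a : nat -> nat) (n : nat) :
  (forall h, (1 <= h)%N -> (0 < a h)%N) ->
  cfrac R a n = (cf_num a n)%:R / (cf_den a n)%:R.
Proof.
move=> a0; case: n => [|n]; first by rewrite /cfrac /= mul0r.
pose f := fun (b : nat) (x : R) => (b%:R + x)^-1.
have key m (x : R) : 0 <= x -> foldr f x [seq a h | h <- iota 1 m.+1] =
    ((cf_num a m.+1)%:R + x * (cf_num a m)%:R) /
    ((cf_den a m.+1)%:R + x * (cf_den a m)%:R).
  elim: m x => [|m IH] x x0; first by rewrite /= /f mulr0 mulr1 addr0 div1r.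
  rewrite -(addn1 m.+1) iotaD map_cat foldr_cat IH /=; last first.
    by rewrite invr_ge0 addr_ge0.
  rewrite addn1 -/(cf_num a m.+1) -/(cf_den a m.+1) add1n /f !natrD !natrM.
  have q1 : 0 < (cf_den a m.+1)%:R :> R by rewrite ltr0n cf_den_gt0.
  have q0 : 0 < (cf_den a m)%:R :> R by rewrite ltr0n cf_den_gt0.
  have am : 0 < (a m.+2)%:R :> R by rewrite ltr0n a0.
  move: q1 q0 am; move: (cf_den _ _)%:R (cf_den _ _)%:R (a _)%:R => v u w.
  move: (cf_num _ _)%:R (cf_num _ _)%:R => s t u0 v0 w0.
  have wx : 0 < w + x by rewrite ltr_pwDl.
  have h1 : 0 < (w + x) * u + v by rewrite addr_gt0 ?mulr_gt0.
  have h2 : 0 < w * u + v + x * u by rewrite addrAC -mulrDl.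
  by field; rewrite (lt0r_neq0 wx) (lt0r_neq0 h2).
by rewrite /cfrac key// !mul0r !addr0.
Qed.

(* The minimum of a nonempty set of naturals (0 on the empty set). *)
Definition least (A : set nat) : nat :=
  xget 0%N [set n | A n /\ forall m, A m -> (n <= m)%N].

Lemma leastP (A : set nat) : A !=set0 ->
  A (least A) /\ forall m, A m -> (least A <= m)%N.
Proof.
move=> [n0 An0]; have ex : exists n, `[< A n >] by exists n0; apply/asboolP.
have [n /asboolP An nmin] := ex_minnP ex.
rewrite /least; case: xgetP => [x -> //|/(_ n)[]]; split=> // m Am.
by apply: nmin; apply/asboolP.
Qed.

Definition floor_fiber (R : realType) (alpha : R) (k : nat) : set nat :=
  [set r | Num.floor (r%:R * alpha) = k%:Z].

Definition rmin (R : realType) (alpha : R) (k : nat) : nat :=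
  least (floor_fiber alpha k).

(* The fibers are finite for alpha > 0, so that [fset_set] is faithful. *)
Definition tcard (R : realType) (alpha : R) (k : nat) : nat :=
  #|` fset_set (floor_fiber alpha k)|.

(* Increasing enumeration of the k such that t_k = a_1 + 1. *)
Fixpoint kenum (R : realType) (alpha : R) (a : nat -> nat) (j : nat) : nat :=
  match j with
  | 0%N => least [set k | tcard alpha k = (a 1).+1]
  | i.+1 => least [set k | (kenum alpha a i < k)%N /\ tcard alpha k = (a 1).+1]
  end%N.

(* r = \sum_(h <= N) c_h q_h is the Ostrowski representation of r; the digits
   are extended by 0 beyond N, which makes c_1 meaningful when N = 0. *)
Definition ostrowski (a : nat -> nat) (r N : nat) (c : nat -> nat) : Prop :=
  [/\ r = (\sum_(h < N.+1) c h * cf_den a h)%N,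
      (c 0 <= a 1 - 1)%N,
      forall h, (1 <= h)%N ->
        (c h <= a h.+1)%N /\ (c h = a h.+1 -> c h.-1 = 0%N),
      (0 < c N)%N &
      forall h, (N < h)%N -> c h = 0%N].

(* Main.v *)
Require Import Defs.
From mathcomp Require Import all_boot all_order all_algebra.
From mathcomp Require Import boolp classical_sets reals topology normedtype.
From mathcomp Require Import finmap cardinality ring lra zify.
Import Order.TTheory GRing.Theory Num.Theory.
Import numFieldNormedType.Exports.
Local Open Scope classical_set_scope.
Local Open Scope ring_scope.

(** Everything is read off from the fractional part {r alpha}. Write p_h/q_h for
the convergents and D_h = (-1)^h (q_h alpha - p_h), so that D_0 = alpha and
D_1 = 1 - a_1 alpha.

- r is the first element of a floor fiber exactly when r alpha has just passed
  an integer, i.e. {r alpha} < alpha ([rmin_frac_lt]). The fiber starting at r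
  is long, with a_1 + 1 elements, exactly when moreover
  {r alpha} + a_1 alpha < 1, i.e. {r alpha} < D_1 ([tcard_long]). Hence the
  numbers r_{k_j} are those with {r alpha} < D_1 ([rmin_kenum]).

- The D_h are positive and satisfy D_h = a_{h+2} D_{h+1} + D_{h+2}
  ([cf_err_gt0], [cf_errE]). If r = sum c_h q_h with lowest nonzero digit c_m,
  then r alpha differs from an integer by the alternating sum
  (-1)^m (c_m D_m - c_{m+1} D_{m+1} + ...). The digit bounds c_h <= a_{h+1}
  confine every tail of this sum ([ost_tail_bounds]), which places it in
  ]0, D_1[ for even m >= 2 and in ]-alpha, 0[ for odd m. For m = 0 it lies in
  ]D_1, 1[, because c_0 < a_1 and because c_0 > 0 forces c_1 < a_2. Only
  the first range meets [0, D_1[ modulo 1 ([ostrowski_frac_lt]).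

- The first fiber after a long one starts a_1 + 1 later, which adds alpha - D_1
  to the fractional part; each further short fiber has length a_1 and subtracts
  D_1. Since a_2 D_1 < alpha < (a_2 + 1) D_1, going backwards from any start of
  a short fiber reaches the start of a long one after between 1 and a_2 fibers
  ([frac_lt_short_steps]), and conversely each such start is obtained. *)

(** * Approximation errors of the convergents *)

Lemma least_unique (A : set nat) n :
  A n -> (forall m, A m -> (n <= m)%N) -> least A = n.
Proof.
move=> An nmin; have [Al lmin] := leastP (ex_intro _ n An : A !=set0).
by apply/eqP; rewrite eqn_leq lmin//= nmin.
Qed.

(** The factor (-1)^h compensates the alternation of the convergents around
alpha: these are the distances |q_h alpha - p_h|, without absolute values so
that the recurrence is linear. *)
Definition cf_err {R : realType} (alpha : R) (a : nat -> nat) (h : nat) : R :=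
  (-1) ^+ h * ((cf_den a h)%:R * alpha - (cf_num a h)%:R).

Lemma cf_errE {R : realType} (alpha : R) a h :
  cf_err alpha a h = (a h.+2)%:R * cf_err alpha a h.+1 + cf_err alpha a h.+2.
Proof.
rewrite /cf_err [in X in _ + X]/= -/(cf_den a h.+1) -/(cf_num a h.+1).
by rewrite !exprS !natrD !natrM; ring.
Qed.

Lemma cf_det (R : realType) (a : nat -> nat) h :
  (-1) ^+ h * ((cf_num a h.+1)%:R * (cf_den a h)%:R
                - (cf_num a h)%:R * (cf_den a h.+1)%:R) = 1 :> R.
Proof.
elim: h => [|h IH]; first by rewrite /= expr0; ring.
rewrite -[RHS]IH [cf_num a h.+2]/= [cf_den a h.+2]/=.
rewrite -/(cf_den a h.+1) -/(cf_num a h.+1) exprS !natrD !natrM; ring.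
Qed.

(** For fixed h, the cross determinant satisfies in m the recurrence of
numerators and denominators, whose coefficients are positive, with initial
values 0 and 1. It says on which side of p_h/q_h the later convergents lie. *)
Lemma cf_cross_ge0 (R : realType) (a : nat -> nat) h m :
  0 <= (-1) ^+ h * ((cf_num a (h + m))%:R * (cf_den a h)%:R
                - (cf_num a h)%:R * (cf_den a (h + m))%:R) :> R.
Proof.
pose E m : R := (-1) ^+ h * ((cf_num a (h + m))%:R * (cf_den a h)%:R
                - (cf_num a h)%:R * (cf_den a (h + m))%:R).
rewrite -/(E m); suff /andP[] : (0 <= E m) && (0 <= E m.+1) by [].
elim: m => [|m /andP[E0 E1]].
  by rewrite /E addn1 cf_det addn0 subrr mulr0 lexx ler01.
rewrite E1 /=; suff -> : E m.+2 = (a (h + m).+2)%:R * E m.+1 + E m.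
  by rewrite addr_ge0// mulr_ge0.
rewrite /E !addnS [cf_num a _.+2]/= [cf_den a _.+2]/=.
by rewrite -/(cf_den a (h+m).+1) -/(cf_num a (h+m).+1) !natrD !natrM; ring.
Qed.

(** All convergents from the h-th on lie on one side of p_h/q_h, hence so does
their limit alpha; irrationality excludes equality. *)
Lemma cf_err_gt0 {R : realType} {alpha : R} {a} h :
  irrational alpha -> is_cfrac alpha a -> 0 < cf_err alpha a h.
Proof.
move=> irr [a0 lim]; rewrite lt_neqAle; apply/andP; split.
  have q0 : (cf_den a h)%:R != 0 :> R by rewrite pnatr_eq0 -lt0n cf_den_gt0.
  apply/eqP => /esym/eqP; rewrite /cf_err mulf_eq0 signr_eq0/= subr_eq0 => /eqP e.
  apply: irr; exists ((cf_num a h)%:R / (cf_den a h)%:R) => //.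
  by rewrite fmorph_div/= !ratr_nat -e mulrC mulKf.
pose f n : R := (-1) ^+ h * ((cf_den a h)%:R * cfrac R a n - (cf_num a h)%:R).
have cf : f n @[n --> \oo] --> cf_err alpha a h.
  apply: cvgM; first exact: cvg_cst.
  by apply: cvgB; [apply: cvgM => //; exact: cvg_cst|exact: cvg_cst].
rewrite -(cvg_lim _ cf)//; apply: limr_ge; first by apply/cvg_ex; eexists; exact: cf.
exists h => // n /= hn; rewrite /f cfrac_convergent// -(subnKC hn).
set m := (n - h)%N.
have qm : 0 < (cf_den a (h + m))%:R :> R by rewrite ltr0n cf_den_gt0.
rewrite -(pmulr_lge0 _ qm); apply: le_trans (cf_cross_ge0 R a h m) _.
by rewrite le_eqVlt; apply/orP; left; apply/eqP; field; rewrite gt_eqF.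
Qed.

Lemma cf_err_ltS {R : realType} {alpha : R} {a} h :
  (forall h, (0 < a h.+1)%N) -> (forall h, 0 < cf_err alpha a h) ->
  cf_err alpha a h.+1 < cf_err alpha a h.
Proof.
move=> a0 D0; have : 1 <= (a h.+2)%:R :> R by rewrite ler1n a0.
by have := cf_errE alpha a h; have := D0 h.+1; have := D0 h.+2; nra.
Qed.

Lemma cf_err_anti {R : realType} {alpha : R} {a m n} :
  (forall h, (0 < a h.+1)%N) -> (forall h, 0 < cf_err alpha a h) ->
  (m <= n)%N -> cf_err alpha a n <= cf_err alpha a m.
Proof.
move=> a0 D0 /subnK <-; elim: (n - m)%N => // i; apply: le_trans.
exact: ltW (cf_err_ltS _ a0 D0).
Qed.

(** * Fibers of the floor in terms of fractional parts *)

(** For 0 < beta <= 1 this says that the fractional part of r * alpha is smaller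
than beta: the integer n is then forced to be the floor. *)
Definition frac_lt {R : realType} (alpha beta : R) (r : nat) : Prop :=
  exists n : int, 0 <= r%:R * alpha - n%:~R < beta.

Lemma floor_fiberE {R : realType} (alpha : R) k r :
  floor_fiber alpha k r <-> k%:R <= r%:R * alpha < k%:R + 1.
Proof.
split=> [/eqP|h]; last apply/eqP.
  by rewrite floor_eq intrD -!pmulrn.
by rewrite floor_eq intrD -!pmulrn.
Qed.

(** One step back subtracts alpha from r * alpha and so leaves the fiber. *)
Lemma rmin_unique {R : realType} {alpha : R} {k r} : 0 < alpha < 1 ->
  k%:R <= r%:R * alpha < k%:R + alpha -> rmin alpha k = r.
Proof.
move=> alpha01 kr; apply: least_unique; first by apply/floor_fiberE; lra.
move=> m /floor_fiberE km; rewrite leqNgt; apply/negP => mr.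
have : m%:R + 1 <= r%:R :> R by rewrite natr1 ler_nat.
nra.
Qed.

Lemma rminP {R : realType} {alpha : R} k : 0 < alpha < 1 ->
  k%:R <= (rmin alpha k)%:R * alpha < k%:R + alpha.
Proof.
move=> alpha01; have ex : exists r, k%:R <= r%:R * alpha.
  exists (Num.truncn (k%:R / alpha)).+1.
  by rewrite -ler_pdivrMr; [apply: ltW; exact: truncnS_gt|lra].
suff [r kr] : exists r, k%:R <= r%:R * alpha < k%:R + alpha.
  by rewrite (rmin_unique alpha01 kr).
have [r kr rmn] := ex_minnP ex; exists r; rewrite kr /=.
case: r kr rmn => [|r] kr rmn.
  by rewrite mul0r; have := ler0n R k; lra.
have : ~~ (k%:R <= r%:R * alpha) by apply/negP => /rmn; rewrite ltnn.
by rewrite -ltNge -natr1; lra.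
Qed.

Lemma rmin0 {R : realType} {alpha : R} : 0 < alpha < 1 -> rmin alpha 0 = 0%N.
Proof. by move=> alpha01; apply: rmin_unique => //; rewrite mul0r; lra. Qed.

(** In this form, beta = alpha describes the starts of all fibers, and
beta = 1 - a_1 alpha those of the long ones. *)
Lemma rmin_frac_lt {R : realType} {alpha beta : R} {r} : 0 < alpha < 1 ->
  beta <= alpha ->
  frac_lt alpha beta r <->
  exists2 k, r = rmin alpha k & (rmin alpha k)%:R * alpha - k%:R < beta.
Proof.
move=> alpha01 leb; split=> [[n nr]|[k -> kr]]; last first.
  by exists k; have := rminP k alpha01; rewrite -pmulrn; lra.
have : (0 <= n)%R.
  have : (-1)%:~R < n%:~R :> R by have := ler0n R r; rewrite rmorphN1; nra.
  by rewrite ltr_int; lia.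
case: n nr => // k; rewrite -pmulrn => kr _.
have rE : rmin alpha k = r by apply: rmin_unique => //; lra.
by exists k; rewrite rE //; lra.
Qed.

(** A fiber is an interval of integers, so its cardinal is determined by the
first r that lies beyond it. *)
Lemma tcard_eq {R : realType} {alpha : R} {k t} : 0 < alpha < 1 ->
  k%:R + 1 <= (rmin alpha k + t)%:R * alpha < k%:R + 1 + alpha ->
  tcard alpha k = t.
Proof.
rewrite natrD => alpha01 kt; have kr := rminP k alpha01.
rewrite /tcard; have -> : floor_fiber alpha k =
    [set` [fset x in iota (rmin alpha k) t]%fset].
  apply/seteqP; split=> m /=; rewrite in_fset/= mem_iota.
    move=> km; apply/andP; split.
      exact: (leastP (ex_intro _ m km : floor_fiber alpha k !=set0)).2.
    by move/floor_fiberE: km => km; rewrite -(ltr_nat R) natrD; nra.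
  rewrite -(ler_nat R) -(ler_nat R m.+1) natrD -natr1 => /andP[m1 m2].
  apply/floor_fiberE; nra.
by rewrite set_fsetK card_fseq undup_id ?iota_uniq// size_iota.
Qed.

(** The fiber starting at r has b or b + 1 elements, and r + b still belongs to
it when adding b * alpha to the fractional part of r * alpha does not reach 1. *)
Lemma tcard_long {R : realType} {alpha : R} b k :
  0 < alpha < 1 -> b%:R * alpha < 1 < b.+1%:R * alpha ->
  tcard alpha k = b.+1 <-> (rmin alpha k)%:R * alpha - k%:R < 1 - b%:R * alpha.
Proof.
move=> alpha01; rewrite -natr1 => ba; have kr := rminP k alpha01.
split=> [tk|kb]; last by apply: tcard_eq => //; rewrite natrD -natr1; lra.
rewrite ltNge; apply/negP => bk; suff : tcard alpha k = b by lia.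
by apply: tcard_eq => //; rewrite natrD; lra.
Qed.

(** If the enumeration stops being strictly increasing, the set of remaining
long fibers is empty and [least] returns 0, which is again the index of a long
fiber; so the range is correct whether or not the long fibers are known to be
infinitely many. A long fiber k that was never reached would bound all terms of
a strictly increasing sequence. *)
Lemma kenumP {R : realType} {alpha : R} {a : nat -> nat} k :
  tcard alpha 0 = (a 1).+1 ->
  (exists j, k = kenum alpha a j) <-> tcard alpha k = (a 1).+1.
Proof.
move=> t0; have k0 : kenum alpha a 0 = 0%N by exact: least_unique.
split=> [[j ->]|tk].
  elim: j => [|j IH]; first by rewrite k0.
  have [ne|/set0P/negP] := pselect
    ([set k | (kenum alpha a j < k)%N /\ tcard alpha k = (a 1).+1] !=set0).
    exact: (leastP ne).1.2.
  rewrite negbK => /eqP e0; rewrite /= e0 /least.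
  by case: xgetP => // n _ [].
apply: contrapT => nk.
suff jk j : (j <= kenum alpha a j < k)%N by have /andP[] := jk k; lia.
elim: j => [|j /andP[IH1 IH2]].
  by rewrite k0 /= lt0n; apply/eqP => k00; apply: nk; exists 0%N; rewrite k0.
have [[lt1 _] lt2] := leastP (ex_intro _ k (conj IH2 tk) :
  [set k | (kenum alpha a j < k)%N /\ tcard alpha k = (a 1).+1] !=set0).
have := lt2 _ (conj IH2 tk); rewrite -/(kenum alpha a j.+1) leq_eqVlt.
case/orP => [/eqP e|->]; first by case: nk; exists j.+1.
by rewrite andbT (leq_ltn_trans IH1).
Qed.

Lemma rmin_kenum {R : realType} {alpha : R} {a : nat -> nat} r :
  0 < alpha < 1 -> (a 1)%:R * alpha < 1 < (a 1).+1%:R * alpha ->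
  (exists j, r = rmin alpha (kenum alpha a j)) <->
  frac_lt alpha (1 - (a 1)%:R * alpha) r.
Proof.
move=> alpha01 ba; have t0 : tcard alpha 0 = (a 1).+1.
  by apply/tcard_long => //; rewrite rmin0// mul0r; lra.
rewrite rmin_frac_lt//; last by move: ba; rewrite -natr1; lra.
split=> [[j ->]|[k -> kb]].
  by eexists => //; apply/(tcard_long _ _ alpha01 ba)/(kenumP _ t0); exists j.
by have /(kenumP _ t0)[j ->] := (tcard_long _ _ alpha01 ba).2 kb; exists j.
Qed.

Lemma rmin_kenum_gt0 {R : realType} {alpha : R} {a : nat -> nat} r :
  0 < alpha < 1 -> (a 1)%:R * alpha < 1 < (a 1).+1%:R * alpha -> (0 < r)%N ->
  (exists j, (0 < j)%N /\ r = rmin alpha (kenum alpha a j)) <->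
  frac_lt alpha (1 - (a 1)%:R * alpha) r.
Proof.
move=> alpha01 ba r0; rewrite -rmin_kenum//; split=> [[j [_ ->]]|[j rj]].
  by exists j.
exists j; split=> //; case: j rj => // rE; move: r0; rewrite rE.
have -> : kenum alpha a 0 = 0%N; last by rewrite rmin0.
apply: least_unique => //=; apply/tcard_long => //; rewrite rmin0// mul0r; lra.
Qed.

(** * The Ostrowski expansion *)

(** The alternating sum of the terms m, ..., m + n - 1, signed so that the term
m counts positively. *)
Definition ost_tail {R : realType} (alpha : R) (a c : nat -> nat) m n : R :=
  \sum_(i < n) (-1) ^+ i * ((c (m + i)%N)%:R * cf_err alpha a (m + i)).

Lemma ost_tailS {R : realType} (alpha : R) a c m n :
  ost_tail alpha a c m n.+1 =
  (c m)%:R * cf_err alpha a m - ost_tail alpha a c m.+1 n.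
Proof.
rewrite /ost_tail big_ord_recl addn0 expr0 mul1r; congr (_ + _).
rewrite -sumrN; apply: eq_bigr => i _.
by rewrite lift0 exprS -addSnnS mulN1r mulNr.
Qed.

(** Since the tail at m is c_m D_m minus the tail at m + 1, both bounds
propagate at once: c_m >= 0 and a tail at m + 1 below D_m give the lower bound,
c_m <= a_{m+1} and D_{m-1} = a_{m+1} D_m + D_{m+1} give the upper one. *)
Lemma ost_tail_bounds {R : realType} {alpha : R} {a c} m n :
  (forall h, 0 < cf_err alpha a h) ->
  (forall h, (1 <= h)%N -> (c h <= a h.+1)%N) ->
  - cf_err alpha a m.+1 < ost_tail alpha a c m.+1 n < cf_err alpha a m.
Proof.
move=> D0 ca; elim: n m => [|n IH] m.
  by rewrite /ost_tail big_ord0 oppr_lt0 !D0.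
rewrite ost_tailS; have /andP[IH1 IH2] := IH m.+1.
have c0 : 0 <= (c m.+1)%:R :> R by [].
have c1 : (c m.+1)%:R <= (a m.+2)%:R :> R by rewrite ler_nat ca.
by have := cf_errE alpha a m; have := D0 m.+1; nra.
Qed.

Lemma ost_expansion {R : realType} (alpha : R) a {c m N} : (m <= N)%N ->
  (forall h, (h < m)%N -> c h = 0%N) ->
  (\sum_(h < N.+1) c h * cf_den a h)%N%:R * alpha
    - (\sum_(h < N.+1) c h * cf_num a h)%N%:R =
  (-1) ^+ m * ost_tail alpha a c m (N.+1 - m).
Proof.
move=> mN cz; rewrite !natr_sum mulr_suml -sumrB.
pose F h := (c h)%:R * ((cf_den a h)%:R * alpha - (cf_num a h)%:R) : R.
transitivity (\sum_(0 <= h < N.+1) F h).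
  by rewrite big_mkord; apply: eq_bigr => h _; rewrite /F !natrM; ring.
rewrite (big_cat_nat _ (n := m))//=; last exact: leqW.
rewrite big_nat big1 ?add0r => [|h /= hm]; last by rewrite /F cz// mul0r.
rewrite -{1}[m]add0n big_addn big_mkord /ost_tail mulr_sumr.
apply: eq_bigr => i _; rewrite /F /cf_err addnC exprD.
(* The signs in [ost_tail] and [cf_err] cancel. *)
have s x : (-1) ^+ x * (-1) ^+ x = 1 :> R by rewrite -expr2 sqrr_sign.
transitivity (((-1) ^+ m * (-1) ^+ m) * ((-1) ^+ i * (-1) ^+ i) *
  ((c (m + i))%:R * ((cf_den a (m + i))%:R * alpha - (cf_num a (m + i))%:R))) => //.
  by rewrite !s !mul1r.
by ring.
Qed.

(** * Short fibers following a long one *)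

(** Induction on r, going back by one short fiber (r - a_1, which adds D_1 to
the fractional part) as long as the fractional part stays below alpha.
Otherwise the preceding fiber is long and starts at r - a_1 - 1. Here b and e
stand for a_1 and a_2, and D_1 for 1 - b alpha. The bound c <= e follows at
the end: the fractional part at r is at least D_1 and equals alpha - c D_1 plus
that at r', which is below D_1; hence c D_1 < alpha. *)
Lemma frac_lt_short_steps {R : realType} {alpha : R} b e r : 0 < alpha < 1 ->
  (0 < b)%N -> b%:R * alpha < 1 -> alpha < e.+1%:R * (1 - b%:R * alpha) ->
  (0 < r)%N ->
  frac_lt alpha alpha r -> ~ frac_lt alpha (1 - b%:R * alpha) r ->
  exists r' c, [/\ frac_lt alpha (1 - b%:R * alpha) r', (1 <= c <= e)%N &
                   r = (r' + c * b + 1)%N].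
Proof.
move=> alpha01 b0 b1 eD r0 [n nr] nfr.
have nD : 1 - b%:R * alpha <= r%:R * alpha - n%:~R.
  by rewrite leNgt; apply/negP => lt; apply: nfr; exists n; lra.
suff [r' [c [c0 rE rD]]] : exists r' c, [/\ (0 < c)%N, r = (r' + c * b + 1)%N &
    0 <= r'%:R * alpha - (n - c%:Z)%:~R < 1 - b%:R * alpha].
  exists r', c; split=> //; first by exists (n - c%:Z).
  rewrite c0 -ltnS -(ltr_nat R); move: rD nD; rewrite rE !natrD natrM.
  rewrite rmorphB/= -pmulrn.
  have : 0 <= (1 - b%:R * alpha) by lra.
  nra.
elim/ltn_ind: r {nfr} r0 n nr nD => r IH r0 n nr nD.
(* For 0 < r <= b, the fractional part of r * alpha is r * alpha itself, which
   is not below alpha. *)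
have br : (b < r)%N.
  rewrite ltnNge; apply/negP => rb.
  have rb' : r%:R <= b%:R :> R by rewrite ler_nat.
  have r1 : 1 <= r%:R :> R by rewrite ler1n.
  have n1 : n%:~R < 1%:~R :> R by nra.
  have n2 : (-1)%:~R < n%:~R :> R by rewrite rmorphN1; nra.
  move: n1 n2; rewrite !ltr_int => n1 n2; have n0 : n = 0 by lia.
  by move: nr; rewrite n0; nra.
have [lt|ge] := ltP (r%:R * alpha - n%:~R + (1 - b%:R * alpha)) alpha.
  have rbE : (r - b)%:R = r%:R - b%:R :> R by rewrite natrB// ltnW.
  have n1E : (n - 1)%:~R = n%:~R - 1 :> R by rewrite rmorphB.
  have nD' : 1 - b%:R * alpha <= (r - b)%:R * alpha - (n - 1)%:~R.
    by rewrite rbE n1E; lra.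
  have [|||//|r' [c [c0 rE rD]]] := IH (r - b)%N _ _ (n - 1); [lia|lia| |].
    by rewrite rbE n1E; lra.
  exists r', c.+1; split=> //; first by rewrite mulSn; lia.
  by move: rD; rewrite (_ : n - 1 - c%:Z = n - c.+1%:Z)//; lia.
exists (r - b - 1)%N, 1%N; split=> //; first by lia.
by rewrite -subnDA natrB ?natrD ?rmorphB/=; [lra|lia].
Qed.

(** The lowest nonzero digit decides in which part of the circle r * alpha
lies. Comparing with [0, D_1[ modulo 1 amounts to showing, in the cases where m
is odd or 0, that an integer z would lie strictly between -1 and 0, or strictly
between 0 and 1, respectively. *)
Lemma ostrowski_frac_lt {R : realType} {alpha : R} {a r N c} :
  (forall h, (0 < a h.+1)%N) -> (forall h, 0 < cf_err alpha a h) ->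
  ostrowski a r N c ->
  frac_lt alpha (cf_err alpha a 1) r <->
  [/\ c 0%N = 0%N, c 1%N = 0%N, ~~ odd (least [set h | (0 < c h)%N]) &
      (2 <= least [set h | (0 < c h)%N])%N].
Proof.
move=> a0 D0 [rE c0a ca cN cz].
have [cm mmin] := leastP (ex_intro _ N cN : [set h | (0 < c h)%N] !=set0).
move: (least _) cm mmin => m cm mmin.
have mN : (m <= N)%N by exact: mmin.
have cltm h : (h < m)%N -> c h = 0%N.
  by move=> hm; apply/eqP; rewrite -leqn0 leqNgt; apply/negP => /mmin; rewrite leqNgt hm.
have := ost_expansion alpha a mN cltm; rewrite -rE.
set P := (\sum_(h < N.+1) _)%N; rewrite subSn// ost_tailS => S.
have ca' h : (1 <= h)%N -> (c h <= a h.+1)%N by move=> /ca[].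
have cm1 : 1 <= (c m)%:R :> R by rewrite ler1n.
have /andP[T1 T2] := ost_tail_bounds m (N - m) D0 ca'.
have D0E : cf_err alpha a 0 = alpha by rewrite /cf_err /=; ring.
have D1E : cf_err alpha a 1 = 1 - (a 1)%:R * alpha by rewrite /cf_err /=; ring.
have a1 : 1 <= (a 1)%:R :> R by rewrite ler1n a0.
split; last first.
  case=> _ _ meven m2; exists P; rewrite -pmulrn S -signr_odd (negbTE meven) mul1r.
  case: (m) m2 cm cm1 T1 T2 => [//|k] k1 cm cm1 T1 T2.
  have := cf_err_anti a0 D0 (k1 : (1 <= k)%N).
  have : (c k.+1)%:R <= (a k.+2)%:R :> R by rewrite ler_nat ca'.
  by have := cf_errE alpha a k; have := D0 k.+1; nra.
case=> n; have -> : n%:~R = P%:R + (n - P%:Z)%:~R :> R.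
  by rewrite rmorphB/= -pmulrn; ring.
rewrite opprD addrA S; move: (n - P%:Z : int) => z nz.
have [modd|meven] := boolP (odd m).
  case: (m) modd cm cm1 T1 T2 nz => [//|k] kodd cm cm1 T1 T2.
  rewrite -signr_odd kodd expr1 mulN1r => nz; exfalso.
  have [T3 T4] : - alpha < z%:~R + cf_err alpha a 1 /\ z%:~R < 0 :> R.
    have := cf_err_anti a0 D0 (leq0n k); rewrite D0E.
    have : (c k.+1)%:R <= (a k.+2)%:R :> R by rewrite ler_nat ca'.
    by have := cf_errE alpha a k; have := D0 k.+1; split; nra.
  have : (-1)%:~R < z%:~R :> R.
    by rewrite rmorphN1; have := D0 0%N; rewrite D0E; nra.
  by move: T4; rewrite -[0]/(0%:~R) !ltr_int; lia.
case: m cm {mmin mN} cltm cm1 meven T1 T2 S nz => [|[//|m]] cm cltm cm1 meven T1 T2 S nz.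
  exfalso; move: T1 nz; rewrite subn0 expr0 mul1r D0E => T1 nz.
  have c0a' : (c 0%N)%:R + 1 <= (a 1)%:R :> R.
    by rewrite natr1 ler_nat (leq_ltn_trans c0a)// subn1 prednK // a0.
  (* As c_0 > 0, the digit c_1 cannot be maximal; this improves the general
     upper bound alpha on the tail by D_1. *)
  have T3 : ost_tail alpha a c 1 N < alpha - cf_err alpha a 1.
    have D1 := D0 1%N; have D2 := D0 2; have DE := cf_errE alpha a 0.
    have a2 : 1 <= (a 2)%:R :> R by rewrite ler1n a0.
    case: (N) => [|n']; first by rewrite /ost_tail big_ord0; nra.
    have /andP[T3 T4] := ost_tail_bounds 1 n' D0 ca'.
    have c1a : (c 1%N)%:R + 1 <= (a 2)%:R :> R.
      rewrite natr1 ler_nat ltn_neqAle ca'// andbT; apply/eqP => /((ca 1%N _).2).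
      by move=> /(_ isT) /= c00; move: cm; rewrite /= c00.
    by rewrite ost_tailS; nra.
  have := D0 0%N; rewrite D0E => al0.
  have [z0 z1] : 0%:~R < z%:~R :> R /\ z%:~R < 1%:~R :> R by split; nra.
  by move: z0 z1; rewrite !ltr_int; lia.
by split=> //; exact: cltm.
Qed.

(** * The two characterizations *)

Theorem theorem2p3 (R : realType) (alpha : R) (a : nat -> nat)
    (alpha01 : 0 < alpha < 1) (alphaI : irrational alpha)
    (alphaE : is_cfrac alpha a) :
  (forall (r N : nat) (c : nat -> nat), (0 < r)%N -> ostrowski a r N c ->
     ((exists j : nat, (0 < j)%N /\ r = rmin alpha (kenum alpha a j)) <->
      [/\ c 0%N = 0%N, c 1%N = 0%N,
          ~~ odd (least [set h | (0 < c h)%N]) &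
          (2 <= least [set h | (0 < c h)%N])%N])) /\
  (forall r : nat, (0 < r)%N ->
     ((exists k : nat, r = rmin alpha k) <->
      (exists j : nat, (0 < j)%N /\ r = rmin alpha (kenum alpha a j)) \/
      (exists j c1 : nat, (1 <= c1 <= a 2)%N /\
         r = (rmin alpha (kenum alpha a j) + c1 * cf_den a 1 + 1)%N))).
Proof.
have D0 h : 0 < cf_err alpha a h by exact: cf_err_gt0.
have a0 h : (0 < a h.+1)%N by case: alphaE => + _; exact.
have D0E : cf_err alpha a 0 = alpha by rewrite /cf_err /=; ring.
have D1E : cf_err alpha a 1 = 1 - (a 1)%:R * alpha by rewrite /cf_err /=; ring.
have a2 : 1 <= (a 2)%:R :> R by rewrite ler1n a0.
have DE := cf_errE alpha a 0; have D1 := D0 1%N; have D2 := D0 2%N.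
have D21 : cf_err alpha a 2 < cf_err alpha a 1 by exact: cf_err_ltS.
have ba : (a 1)%:R * alpha < 1 < (a 1).+1%:R * alpha.
  by rewrite -natr1; nra.
have rk s : (exists k, s = rmin alpha k) <-> frac_lt alpha alpha s.
  rewrite rmin_frac_lt//; split=> [[k ->]|[k -> _]]; last by exists k.
  by exists k => //; have := rminP k alpha01; lra.
split=> [r N c r0 cE|r r0].
  by rewrite rmin_kenum_gt0// -D1E; exact: ostrowski_frac_lt cE.
rewrite rmin_kenum_gt0// rk; split=> [fr|].
  have [|nfr] := pselect (frac_lt alpha (1 - (a 1)%:R * alpha) r); first by left.
  have b1 : (a 1)%:R * alpha < 1 by lra.
  have e1 : alpha < (a 2).+1%:R * (1 - (a 1)%:R * alpha) by rewrite -D1E -natr1; lra.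
  right; have [r' [c [fr' c12 ->]]] :=
    frac_lt_short_steps _ _ _ alpha01 (a0 0%N) b1 e1 r0 fr nfr.
  have [j ->] := (rmin_kenum r' alpha01 ba).2 fr'.
  by exists j, c.
case=> [[n nr]|[j [c1 [c12 rE]]]]; first by exists n; move: ba; rewrite -natr1; lra.
have /(rmin_kenum _ alpha01 ba)[n nr'] : exists j', rmin alpha (kenum alpha a j) =
  rmin alpha (kenum alpha a j') by exists j.
exists (n + c1%:Z); rewrite rE !natrD natrM rmorphD/= -pmulrn.
case/andP: c12; rewrite -(ler_nat R) -(ler_nat R _ (a 2)) => c11 c12; nra.
Qed.
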